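(* Fix $T>0$ and let $q_\varepsilon$ satisfy $$q_\varepsilon''(t)=-\frac1\varepsilon V'\!\left(\frac{q_\varepsilon(t)}{\varepsilon}\right),\quad t\in\mathbb{R},$$ with $q_\varepsilon(0)=q_a$, $q_\varepsilon(T)=q_b$ and $$\frac12|q_\varepsilon'(t)|^2+V(q_\varepsilon(t)/\varepsilon)=E_\varepsilon\quad\text{for }t\in\mathbb{R},$$ for some $E_\varepsilon>0$. Let $t_\varepsilon$ be defined by $$t_\varepsilon(q)=\int_{q_a}^q\frac{1}{\sqrt{2\left(E_\varepsilon-V(\gamma/\varepsilon)\right)}}\,d\gamma .$$ Then there exist a subsequence (not relabelled) $E_\varepsilon$ and $\bar E>0$ such that $t_\varepsilon\to\bar t$ uniformly, where $\bar t(q)=\sigma(\bar E)(q-q_a)$, and $E_\varepsilon\to\bar E$ as $\varepsilon\to0$.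
   Context: $V\in C^2(\mathbb{R})$ is $1$-periodic with $\max V=0$, and $\varepsilon>0$ is a parameter tending to $0$. The functions $q_\varepsilon\colon\mathbb{R}\to\mathbb{R}$ are taken, without loss of generality, with $q_\varepsilon'>0$ and $q_a<q_b$, where $q_a,q_b\in\mathbb{R}$ are fixed; $t_\varepsilon$ is then the inverse function of $q_\varepsilon$, that is, $t_\varepsilon(q_\varepsilon(t))=t$ for $t\in\mathbb{R}$. For $E>0$, $$\sigma(E):=\int_0^1\frac{1}{\sqrt{2(E-V(\gamma))}}\,d\gamma.$$ *)

(* Defs.v *)
From Stdlib Require Import Reals.
From Coquelicot Require Import Coquelicot.
Open Scope R_scope.

(* [Derive] is total (with a junk value where the derivative does not exist),
   so differentiability has to be required at each order. *)
Definition is_C2 (V : R -> R) : Prop :=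
  (forall x, ex_derive V x) /\
  (forall x, ex_derive (Derive V) x) /\
  (forall x, continuous (Derive (Derive V)) x).

Definition one_periodic (V : R -> R) : Prop := forall x, V (x + 1) = V x.

Definition is_max_value (V : R -> R) (m : R) : Prop :=
  (forall x, V x <= m) /\ (exists x, V x = m).

Definition newton_eq (V : R -> R) (eps : R) (q : R -> R) : Prop :=
  (forall t, ex_derive q t) /\
  (forall t, is_derive (Derive q) t (- (1 / eps) * Derive V (q t / eps))).

Definition energy_eq (V : R -> R) (eps : R) (q : R -> R) (E : R) : Prop :=
  forall t, 1 / 2 * Rabs (Derive q t) ^ 2 + V (q t / eps) = E.

Definition sigma_E (V : R -> R) (E : R) : R :=
  RInt (fun g => 1 / sqrt (2 * (E - V g))) 0 1.

(* [RInt] is oriented, so this also covers [x < qa]. *)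
Definition t_fun (V : R -> R) (eps E qa x : R) : R :=
  RInt (fun g => 1 / sqrt (2 * (E - V (g / eps)))) qa x.

(* [CVU f g c r] is uniform convergence on the open interval (c - r, c + r). *)
Definition CVU_bounded (f : nat -> R -> R) (g : R -> R) : Prop :=
  forall (c : R) (r : posreal), CVU f g c r.

(* Main.v *)
Require Import Defs.
From Stdlib Require Import Reals.
From Coquelicot Require Import Coquelicot.
From Stdlib Require Import Ranalysis5 Lra Lia.
Open Scope R_scope.

(** Write [f_E (g) = 1 / sqrt (2 (E - V g))], a positive, continuous,
    1-periodic function when [E > 0]; its mean over a period is [sigma_E V E].

    The integral of a nonnegative periodic function over an interval differs
    from its mean times the length by at most one period's worth of mass
    ([RInt_periodic_mean]).  After the change of variables [g = eps y] this
    gives [|t_eps (x) - sigma (E) (x - qa)| <= eps sigma (E)] ([t_fun_mean]).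
    Conservation of energy says that [t_eps] inverts [q_eps], hence
    [t_eps (qb) = T] ([t_fun_travel_time]); taking [x = qb] forces
    [sigma (E_eps)] to converge to [s = T / (qb - qa)].

    It remains to invert [sigma].  It is continuous and strictly decreasing on
    the positive half-line, it is at most [1 / sqrt (2 E)], and it is unbounded
    near [0]: at a maximum point [x0] of the C2 function [V] one has
    [V x >= - C (x - x0)^2], so that [f_E] is at least of the order of
    [1 / (sqrt E + |x - x0|)], whose integral diverges logarithmically as [E]
    tends to [0].  Therefore [sigma (Ebar) = s] for some [Ebar > 0], and
    monotonicity turns [sigma (E_eps) -> s] into [E_eps -> Ebar].  In particular
    the whole sequence converges and the extraction can be the identity. *)

(** * Integrals of periodic functions *)

Lemma ex_derive_cont (f : R -> R) (x : R) : ex_derive f x -> continuous f x.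
Proof. exact (ex_derive_continuous (V := R_NormedModule) f x). Qed.

Lemma ex_RInt_cont (f : R -> R) (a b : R) :
  (forall x, continuous f x) -> ex_RInt f a b.
Proof. intros Hf; apply (ex_RInt_continuous (V := R_CompleteNormedModule)); auto. Qed.

Lemma RInt_Chasles_cont (f : R -> R) (a b c : R) :
  (forall x, continuous f x) -> RInt f a b + RInt f b c = RInt f a c.
Proof.
  intros Hf.
  apply (RInt_Chasles (V := R_CompleteNormedModule)); apply ex_RInt_cont; exact Hf.
Qed.

Lemma RInt_period (f : R -> R) (a : R) :
  (forall x, continuous f x) -> one_periodic f ->
  RInt f a (a + 1) = RInt f 0 1 :> R.
Proof.
  intros Hf Hp.
  assert (Hshift : RInt f 1 (a + 1) = RInt f 0 a).
  { replace (RInt f 1 (a + 1)) with (RInt f (1 * 0 + 1) (1 * a + 1))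
      by (f_equal; ring).
    rewrite <- (RInt_comp_lin (V := R_CompleteNormedModule)).
    - apply RInt_ext; intros x _.
      unfold scal; simpl; unfold mult; simpl.
      rewrite !Rmult_1_l; apply Hp.
    - apply ex_RInt_cont; exact Hf. }
  assert (H1 := RInt_Chasles_cont f a 0 1 Hf).
  assert (H2 := RInt_Chasles_cont f a 1 (a + 1) Hf).
  assert (H3 := RInt_Chasles_cont f 0 a 0 Hf).
  rewrite (RInt_point (V := R_CompleteNormedModule)) in H3.
  unfold zero in H3; simpl in H3. lra.
Qed.

Lemma RInt_n_periods (f : R -> R) (a : R) (n : nat) :
  (forall x, continuous f x) -> one_periodic f ->
  RInt f a (a + INR n) = INR n * RInt f 0 1 :> R.
Proof.
  intros Hf Hp; induction n as [|n IH].
  - cbn [INR]; rewrite Rplus_0_r, (RInt_point (V := R_CompleteNormedModule)).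
    unfold zero; simpl; ring.
  - rewrite S_INR, <- (RInt_Chasles_cont f a (a + INR n)) by exact Hf.
    rewrite IH, <- Rplus_assoc, RInt_period by assumption. ring.
Qed.

Lemma RInt_nonneg (f : R -> R) (a b : R) :
  (forall x, continuous f x) -> (forall x, 0 <= f x) ->
  a <= b -> 0 <= RInt f a b.
Proof. intros Hf H0 Hab; apply RInt_ge_0; auto using ex_RInt_cont. Qed.

Lemma RInt_periodic_mean_le (f : R -> R) (a b : R) :
  (forall x, continuous f x) -> one_periodic f -> (forall x, 0 <= f x) ->
  a <= b ->
  Rabs (RInt f a b - RInt f 0 1 * (b - a)) <= RInt f 0 1.
Proof.
  intros Hf Hp H0 Hab.
  destruct (nfloor_ex (b - a)) as [n [Hn1 Hn2]]; [lra|].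
  assert (Hs : 0 <= RInt f 0 1) by (apply RInt_nonneg; auto; lra).
  assert (H1 := RInt_Chasles_cont f a (a + INR n) b Hf).
  assert (H2 := RInt_Chasles_cont f (a + INR n) b (a + INR n + 1) Hf).
  rewrite RInt_n_periods in H1; [| exact Hf | exact Hp].
  rewrite RInt_period in H2 by assumption.
  assert (H3 : 0 <= RInt f (a + INR n) b) by (apply RInt_nonneg; auto; lra).
  assert (H4 : 0 <= RInt f b (a + INR n + 1)) by (apply RInt_nonneg; auto; lra).
  (* Both the integral and [mean * length] lie between [n] and [n + 1] means. *)
  assert (H5 : 0 <= RInt f 0 1 * (b - a - INR n)) by (apply Rmult_le_pos; lra).
  assert (H6 : 0 <= RInt f 0 1 * (INR n + 1 - (b - a))) by (apply Rmult_le_pos; lra).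
  apply Rabs_le; lra.
Qed.

Lemma RInt_periodic_mean (f : R -> R) (a b : R) :
  (forall x, continuous f x) -> one_periodic f -> (forall x, 0 <= f x) ->
  Rabs (RInt f a b - RInt f 0 1 * (b - a)) <= RInt f 0 1.
Proof.
  intros Hf Hp H0.
  destruct (Rle_dec a b) as [Hab|Hab]; [now apply RInt_periodic_mean_le|].
  assert (H := RInt_periodic_mean_le f b a Hf Hp H0 ltac:(lra)).
  assert (H1 := RInt_Chasles_cont f a b a Hf).
  rewrite (RInt_point (V := R_CompleteNormedModule)) in H1.
  unfold zero in H1; simpl in H1.
  replace (RInt f a b - RInt f 0 1 * (b - a))
    with (- (RInt f b a - RInt f 0 1 * (a - b))) by lra.
  now rewrite Rabs_Ropp.
Qed.

(** * The slowness at a given energy *)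

(** The reciprocal of the speed of a particle of energy [E] at position [g]. *)
Definition slowness (V : R -> R) (E g : R) : R := 1 / sqrt (2 * (E - V g)).

Lemma C2_continuous (V : R -> R) : is_C2 V -> forall x, continuous V x.
Proof. intros [H _] x; apply ex_derive_cont, H. Qed.

Section Slowness.

Context (V : R -> R).
Hypothesis HV : forall x, continuous V x.
Hypothesis Hper : one_periodic V.
Hypothesis Hmax : forall x, V x <= 0.

Lemma sqrt_speed_pos (E x : R) : 0 < E -> 0 < sqrt (2 * (E - V x)).
Proof. intros HE; specialize (Hmax x); apply sqrt_lt_R0; lra. Qed.

Lemma slowness_pos (E x : R) : 0 < E -> 0 < slowness V E x.
Proof.
  intros HE; unfold slowness; apply Rdiv_lt_0_compat; [lra|].
  now apply sqrt_speed_pos.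
Qed.

Lemma slowness_continuous (E : R) :
  0 < E -> forall x, continuous (slowness V E) x.
Proof.
  intros HE x; unfold slowness.
  assert (Hs := sqrt_speed_pos E x HE).
  apply (continuous_comp (fun g => sqrt (2 * (E - V g))) (fun y => 1 / y)).
  - apply (continuous_comp (fun g => 2 * (E - V g)) sqrt).
    + apply (continuous_scal_r 2 (fun g => E - V g)).
      apply (continuous_minus (fun _ => E) V); [apply continuous_const | apply HV].
    + apply continuous_sqrt.
  - apply ex_derive_cont; auto_derive; lra.
Qed.

Lemma slowness_periodic (E : R) : one_periodic (slowness V E).
Proof. intros x; unfold slowness; now rewrite Hper. Qed.

Lemma sigma_E_pos (E : R) : 0 < E -> 0 < sigma_E V E.
Proof.
  intros HE; apply (RInt_gt_0 (slowness V E)); [lra | |].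
  - intros x _; now apply slowness_pos.
  - intros x _; now apply slowness_continuous.
Qed.

Lemma sigma_E_decreasing (E E' : R) :
  0 < E -> E < E' -> sigma_E V E' < sigma_E V E.
Proof.
  intros HE HEE'.
  apply (RInt_lt (slowness V E') (slowness V E)); [lra | | |].
  - intros x _; now apply slowness_continuous.
  - intros x _; apply slowness_continuous; lra.
  - intros x _; unfold slowness.
    assert (Hs := sqrt_speed_pos E x HE).
    specialize (Hmax x).
    rewrite !Rdiv_1_l; apply Rinv_lt_contravar.
    + apply Rmult_lt_0_compat; [exact Hs | apply sqrt_lt_R0; lra].
    + apply sqrt_lt_1; lra.
Qed.

Lemma sigma_E_nonincreasing (E E' : R) :
  0 < E -> E <= E' -> sigma_E V E' <= sigma_E V E.
Proof.
  intros HE [H|<-]; [left; now apply sigma_E_decreasing | lra].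
Qed.

(** Since [V <= 0], [(E' - V) / (E - V) <= E' / E <= (E' / E)^2] for
    [E <= E']. *)
Lemma mult_slowness_nondecreasing (E E' x : R) :
  0 < E -> E <= E' -> E * slowness V E x <= E' * slowness V E' x.
Proof.
  intros HE HEE'; unfold slowness.
  assert (Ha := sqrt_speed_pos E x HE).
  assert (Hb := sqrt_speed_pos E' x ltac:(lra)).
  specialize (Hmax x).
  assert (Ha2 := sqrt_sqrt (2 * (E - V x)) ltac:(lra)).
  assert (Hb2 := sqrt_sqrt (2 * (E' - V x)) ltac:(lra)).
  set (a := sqrt (2 * (E - V x))) in *.
  set (b := sqrt (2 * (E' - V x))) in *.
  assert (H : E * b <= E' * a).
  { apply Rsqr_incr_0; [| nra | nra].
    unfold Rsqr.
    replace (E * b * (E * b)) with (E * E * (b * b)) by ring.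
    replace (E' * a * (E' * a)) with (E' * E' * (a * a)) by ring.
    rewrite Ha2, Hb2.
    assert (0 <= E * E' * (E' - E)) by (apply Rmult_le_pos; nra).
    assert (0 <= (E' * E' - E * E) * - V x) by (apply Rmult_le_pos; nra).
    lra. }
  apply (Rmult_le_reg_r (a * b)); [nra|].
  replace (E * (1 / a) * (a * b)) with (E * b) by (field; lra).
  replace (E' * (1 / b) * (a * b)) with (E' * a) by (field; lra).
  exact H.
Qed.

Lemma mult_sigma_E_nondecreasing (E E' : R) :
  0 < E -> E <= E' -> E * sigma_E V E <= E' * sigma_E V E'.
Proof.
  intros HE HEE'.
  assert (Hi : forall e, 0 < e -> e * sigma_E V e
             = RInt (fun x => e * slowness V e x) 0 1).
  { intros e He; symmetry.
    apply (RInt_scal (V := R_CompleteNormedModule) (slowness V e)).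
    apply ex_RInt_cont; now apply slowness_continuous. }
  assert (Hex : forall e, 0 < e -> ex_RInt (fun x => e * slowness V e x) 0 1).
  { intros e He; apply (ex_RInt_scal (V := R_NormedModule) (slowness V e)).
    apply ex_RInt_cont; now apply slowness_continuous. }
  rewrite !Hi by lra.
  apply RInt_le; [lra | apply Hex; lra | apply Hex; lra |].
  intros x _; now apply mult_slowness_nondecreasing.
Qed.

(** As [E * sigma_E V E] increases, [sigma_E V] cannot decrease fast away
    from [0]. *)
Lemma sigma_E_Lipschitz (E0 E E' : R) :
  0 < E0 -> E0 <= E -> E <= E' ->
  sigma_E V E - sigma_E V E' <= (E' - E) * (sigma_E V E0 / E0).
Proof.
  intros H0 HE HEE'.
  assert (H1 := mult_sigma_E_nondecreasing E E' ltac:(lra) HEE').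
  assert (H2 := sigma_E_nonincreasing E0 E' H0 ltac:(lra)).
  assert (H3 := sigma_E_nonincreasing E E' ltac:(lra) HEE').
  apply (Rmult_le_reg_l E0); [lra|].
  replace (E0 * ((E' - E) * (sigma_E V E0 / E0)))
    with ((E' - E) * sigma_E V E0) by (field; lra).
  assert (0 <= (E - E0) * (sigma_E V E - sigma_E V E')) by (apply Rmult_le_pos; lra).
  assert (0 <= (E' - E) * (sigma_E V E0 - sigma_E V E')) by (apply Rmult_le_pos; lra).
  lra.
Qed.

Lemma sigma_E_continuity_pt (E : R) : 0 < E -> continuity_pt (sigma_E V) E.
Proof.
  intros HE e He.
  set (K := sigma_E V (E / 2) / (E / 2)).
  assert (HK : 0 < K).
  { apply Rdiv_lt_0_compat; [apply sigma_E_pos; lra | lra]. }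
  exists (Rmin (E / 2) (e / K)); split.
  { apply Rmin_pos; [lra | now apply Rdiv_lt_0_compat]. }
  intros x [_ Hx]; simpl in *; unfold Rdist in *.
  assert (Hx1 := Rlt_le_trans _ _ _ Hx (Rmin_l _ _)).
  assert (Hx2 := Rlt_le_trans _ _ _ Hx (Rmin_r _ _)).
  assert (HKe : K * Rabs (x - E) < e).
  { apply (Rmult_lt_compat_l K) in Hx2; [|exact HK].
    now replace (K * (e / K)) with e in Hx2 by (field; lra). }
  apply Rabs_def2 in Hx1.
  destruct (Rle_dec x E) as [Hle|Hle].
  - assert (H1 := sigma_E_Lipschitz (E / 2) x E ltac:(lra) ltac:(lra) Hle).
    assert (H2 := sigma_E_nonincreasing x E ltac:(lra) Hle).
    rewrite Rabs_left1 in HKe by lra.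
    fold K in H1; apply Rabs_def1; lra.
  - assert (H1 := sigma_E_Lipschitz (E / 2) E x ltac:(lra) ltac:(lra) ltac:(lra)).
    assert (H2 := sigma_E_nonincreasing E x ltac:(lra) ltac:(lra)).
    rewrite Rabs_right in HKe by lra.
    fold K in H1; apply Rabs_def1; lra.
Qed.

Lemma sigma_E_small (s : R) : 0 < s -> exists E, 0 < E /\ sigma_E V E < s.
Proof.
  (* With this [E], [1 / sqrt (2 E) = s / 2]. *)
  intros Hs; exists (2 / (s * s)).
  assert (HE : 0 < 2 / (s * s)) by (apply Rdiv_lt_0_compat; nra).
  split; [exact HE|].
  set (E := 2 / (s * s)) in *.
  apply Rle_lt_trans with (RInt (fun _ => s / 2) 0 1).
  - apply (RInt_le (slowness V E)); [lra | | |].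
    + apply ex_RInt_cont; now apply slowness_continuous.
    + apply ex_RInt_const.
    + intros x _; unfold slowness.
      assert (Hr : 2 / s <= sqrt (2 * (E - V x))).
      { apply Rsqr_incr_0; [| left; now apply Rdiv_lt_0_compat; lra | apply sqrt_pos].
        specialize (Hmax x).
        rewrite Rsqr_sqrt by lra.
        replace (Rsqr (2 / s)) with (2 * E) by (unfold E, Rsqr; field; lra).
        lra. }
      rewrite Rdiv_1_l.
      replace (s / 2) with (/ (2 / s)) by (field; lra).
      apply Rinv_le_contravar; [now apply Rdiv_lt_0_compat; lra | exact Hr].
  - rewrite (RInt_const (V := R_CompleteNormedModule)).
    unfold scal; simpl; unfold mult; simpl; lra.
Qed.

Lemma t_fun_mean (eps E a x : R) :
  0 < eps -> 0 < E ->
  Rabs (t_fun V eps E a x - sigma_E V E * (x - a)) <= eps * sigma_E V E.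
Proof.
  intros He HE.
  assert (Hc := slowness_continuous E HE).
  assert (Ht : t_fun V eps E a x = eps * RInt (slowness V E) (a / eps) (x / eps)).
  { replace (RInt (slowness V E) (a / eps) (x / eps))
      with (RInt (slowness V E) (/ eps * a + 0) (/ eps * x + 0))
      by (f_equal; field; lra).
    rewrite <- (RInt_comp_lin (V := R_CompleteNormedModule))
      by now apply ex_RInt_cont.
    rewrite (RInt_scal (V := R_CompleteNormedModule)
               (fun y => slowness V E (/ eps * y + 0))).
    - unfold scal; simpl; unfold mult; simpl.
      rewrite <- Rmult_assoc, Rinv_r, Rmult_1_l by lra.
      apply RInt_ext; intros y _; unfold slowness.
      now replace (/ eps * y + 0) with (y / eps) by (field; lra).
    - apply ex_RInt_cont; intros y.
      apply (continuous_comp (fun y => / eps * y + 0) (slowness V E)); [|apply Hc].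
      apply ex_derive_cont; auto_derive; auto. }
  rewrite Ht.
  replace (eps * RInt (slowness V E) (a / eps) (x / eps) - sigma_E V E * (x - a))
    with (eps * (RInt (slowness V E) (a / eps) (x / eps)
                 - sigma_E V E * (x / eps - a / eps))) by (field; lra).
  rewrite Rabs_mult, (Rabs_right eps) by lra.
  apply Rmult_le_compat_l; [lra|].
  apply RInt_periodic_mean; [exact Hc | apply slowness_periodic |].
  intros y; left; now apply slowness_pos.
Qed.

(** [t_fun] measures the time spent between two points of an increasing
    trajectory. *)
Lemma t_fun_travel_time (eps E t : R) (q : R -> R) :
  0 < E -> newton_eq V eps q -> (forall t, 0 < Derive q t) ->
  energy_eq V eps q E ->
  t_fun V eps E (q 0) (q t) = t.
Proof.
  intros HE [Hq1 Hq2] Hpos Hen.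
  unfold t_fun.
  rewrite <- (RInt_comp (V := R_CompleteNormedModule)
               (fun g => 1 / sqrt (2 * (E - V (g / eps)))) q (Derive q)).
  - rewrite (RInt_ext (V := R_CompleteNormedModule) _ (fun _ => 1)).
    + rewrite (RInt_const (V := R_CompleteNormedModule)).
      unfold scal; simpl; unfold mult; simpl; ring.
    + intros x _; unfold scal; simpl; unfold mult; simpl.
      specialize (Hen x); specialize (Hpos x).
      rewrite Rabs_right in Hen by lra.
      replace (2 * (E - V (q x / eps))) with (Rsqr (Derive q x))
        by (unfold Rsqr; lra).
      rewrite sqrt_Rsqr by lra.
      field; lra.
  - intros x _.
    apply (continuous_comp (fun g => g / eps) (slowness V E)).
    + apply (continuous_scal_l (fun g : R => g) (/ eps)), continuous_id.
    + now apply slowness_continuous.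
  - intros x _; split.
    + now apply Derive_correct.
    + apply ex_derive_cont; eexists; apply Hq2.
Qed.

End Slowness.

(** * Divergence of the mean slowness at zero energy *)

Lemma C2_quadratic_at_max (V : R -> R) (x0 : R) :
  is_C2 V -> (forall x, V x <= V x0) ->
  exists C, forall x, x0 <= x <= x0 + 1 -> V x0 - C * (x - x0) ^ 2 <= V x.
Proof.
  intros [H1 [H2 H3]] Hmax.
  assert (Hd0 : Derive V x0 = 0).
  { assert (pr : derivable_pt V x0) by (apply ex_derive_Reals_0, H1).
    rewrite <- (Derive_Reals V x0 pr).
    apply (deriv_maximum V (x0 - 1) (x0 + 1)); [lra | lra | auto]. }
  destruct (continuity_ab_min (Derive (Derive V)) x0 (x0 + 1)) as [m [Hm _]];
    [lra | intros c _; now apply continuity_pt_filterlim, H3 |].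
  exists (Rabs (Derive (Derive V) m)); intros x Hx.
  set (C := Rabs (Derive (Derive V) m)).
  assert (HC := Rle_abs (- Derive (Derive V) m)).
  rewrite Rabs_Ropp in HC; fold C in HC.
  assert (HC0 := Rabs_pos (Derive (Derive V) m)); fold C in HC0.
  assert (mvt : forall f y, (forall z, ex_derive f z) -> x0 <= y ->
            exists c, x0 <= c <= y /\ f y - f x0 = Derive f c * (y - x0)).
  { intros f y Hf Hy.
    destruct (MVT_gen f x0 y (Derive f)) as [c [Hc Hfc]].
    - intros z _; now apply Derive_correct.
    - intros z _; now apply continuity_pt_filterlim, ex_derive_cont.
    - rewrite Rmin_left, Rmax_right in Hc by lra. now exists c. }
  destruct (mvt V x H1 ltac:(lra)) as [c [Hc Hvc]].
  destruct (mvt (Derive V) c H2 ltac:(lra)) as [d [Hd Hvd]].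
  specialize (Hm d ltac:(lra)).
  rewrite Hd0, Rminus_0_r in Hvd.
  assert (0 <= (Derive (Derive V) d + C) * (c - x0)) by (apply Rmult_le_pos; lra).
  assert (0 <= (Derive V c + C * (c - x0)) * (x - x0)) by (apply Rmult_le_pos; lra).
  assert (0 <= C * (x - c) * (x - x0)).
  { apply Rmult_le_pos; [apply Rmult_le_pos|]; lra. }
  lra.
Qed.

Lemma sigma_E_large (V : R -> R) (s : R) :
  is_C2 V -> one_periodic V -> is_max_value V 0 ->
  exists E, 0 < E /\ s < sigma_E V E.
Proof.
  intros HC2 Hper [Hmax [x0 Hx0]].
  assert (HV := C2_continuous V HC2).
  destruct (C2_quadratic_at_max V x0 HC2) as [C0 HC0].
  { intros x; rewrite Hx0; apply Hmax. }
  set (C := Rmax 1 C0).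
  assert (HC1 : 1 <= C) by apply Rmax_l.
  assert (HC2' : C0 <= C) by apply Rmax_r.
  set (k := sqrt (2 * C)).
  assert (Hk : 0 < k) by (apply sqrt_lt_R0; lra).
  assert (Hk2 : k * k = 2 * C) by (apply sqrt_sqrt; lra).
  (* [E = r^2], where [r] solves [- ln r / k = s]. *)
  set (r := exp (- (k * s))).
  assert (Hr : 0 < r) by apply exp_pos.
  assert (HE : 0 < r * r) by nra.
  exists (r * r); split; [exact HE|].
  unfold sigma_E; change (s < RInt (slowness V (r * r)) 0 1).
  rewrite <- (RInt_period _ x0);
    [| now apply slowness_continuous | now apply slowness_periodic].
  set (F := fun x => ln (r + (x - x0)) / k).
  set (f := fun x => / (k * (r + (x - x0)))).
  assert (Hcont : forall x, Rmin x0 (x0 + 1) <= x <= Rmax x0 (x0 + 1) -> continuous f x).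
  { intros x; rewrite Rmin_left, Rmax_right by lra; intros Hx.
    apply ex_derive_cont; unfold f; auto_derive.
    apply Rgt_not_eq, Rmult_lt_0_compat; lra. }
  assert (HI : is_RInt f x0 (x0 + 1) (F (x0 + 1) - F x0)).
  { apply (is_RInt_derive (V := R_CompleteNormedModule) F f); [|exact Hcont].
    intros x; rewrite Rmin_left, Rmax_right by lra; intros Hx.
    unfold F, f; auto_derive; [lra|].
    field; split; lra. }
  apply Rlt_le_trans with (RInt f x0 (x0 + 1)).
  - rewrite (is_RInt_unique _ _ _ _ HI); unfold F.
    replace (r + (x0 - x0)) with r by ring.
    replace (r + (x0 + 1 - x0)) with (r + 1) by ring.
    unfold r at 2; rewrite ln_exp.
    replace (ln (r + 1) / k - - (k * s) / k) with (ln (r + 1) / k + s)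
      by (field; lra).
    assert (0 < ln (r + 1) / k); [|lra].
    apply Rdiv_lt_0_compat; [|exact Hk].
    rewrite <- ln_1; apply ln_increasing; lra.
  - apply RInt_le; [lra | eexists; exact HI | |].
    + apply ex_RInt_cont; now apply slowness_continuous.
    + intros x Hx; unfold f, slowness.
      rewrite Rdiv_1_l.
      apply Rinv_le_contravar; [now apply sqrt_speed_pos|].
      specialize (HC0 x ltac:(lra)); specialize (Hmax x).
      rewrite Hx0 in HC0.
      apply Rsqr_incr_0; [| apply sqrt_pos | apply Rmult_le_pos; lra].
      rewrite Rsqr_sqrt by lra.
      unfold Rsqr.
      set (u := x - x0) in *.
      replace (k * (r + u) * (k * (r + u))) with (k * k * ((r + u) * (r + u))) by ring.
      rewrite Hk2.
      assert (Hu : 0 < u) by (unfold u; lra).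
      assert (0 <= (C - 1) * (r * r)) by (apply Rmult_le_pos; lra).
      assert (0 <= (C - C0) * (u * u)) by (apply Rmult_le_pos; nra).
      assert (0 <= C * (r * u)) by (apply Rmult_le_pos; nra).
      lra.
Qed.

Lemma sigma_E_surjective (V : R -> R) (s : R) :
  is_C2 V -> one_periodic V -> is_max_value V 0 -> 0 < s ->
  exists E, 0 < E /\ sigma_E V E = s.
Proof.
  intros HC2 Hper HM Hs.
  assert (HV := C2_continuous V HC2).
  destruct (sigma_E_large V s HC2 Hper HM) as [E1 [HE1 Hs1]].
  destruct HM as [Hmax _].
  destruct (sigma_E_small V HV Hmax s Hs) as [E2 [HE2 Hs2]].
  assert (H12 : E1 < E2).
  { apply Rnot_le_lt; intros H.
    assert (H' := sigma_E_nonincreasing V HV Hmax E2 E1 HE2 H). lra. }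
  destruct (IVT_interv (fun E => s - sigma_E V E) E1 E2) as [E [HE HsE]];
    [| exact H12 | lra | lra |].
  - intros E HE.
    apply (continuity_pt_minus (fun _ => s) (sigma_E V)).
    + apply continuity_pt_const; intros ? ?; reflexivity.
    + apply sigma_E_continuity_pt; auto; lra.
  - exists E; split; lra.
Qed.

(** * Convergence *)

(** The inverse of a strictly monotone function is continuous; continuity of
    [sigma_E V] itself plays no role here. *)
Lemma sigma_E_lim_inv (V : R -> R) (e : nat -> R) (Ebar : R) :
  (forall x, continuous V x) -> (forall x, V x <= 0) ->
  0 < Ebar -> (forall n, 0 < e n) ->
  is_lim_seq (fun n => sigma_E V (e n)) (sigma_E V Ebar) ->
  is_lim_seq e Ebar.
Proof.
  intros HV Hmax HE He Hlim.
  apply is_lim_seq_spec; intros d.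
  set (d' := Rmin d (Ebar / 2)).
  assert (Hd' : 0 < d') by (apply Rmin_pos; [apply cond_pos | lra]).
  assert (Hd1 : d' <= d) by apply Rmin_l.
  assert (Hd2 : d' <= Ebar / 2) by apply Rmin_r.
  assert (HA := sigma_E_decreasing V HV Hmax (Ebar - d') Ebar ltac:(lra) ltac:(lra)).
  assert (HB := sigma_E_decreasing V HV Hmax Ebar (Ebar + d') ltac:(lra) ltac:(lra)).
  set (g := Rmin (sigma_E V (Ebar - d') - sigma_E V Ebar)
                 (sigma_E V Ebar - sigma_E V (Ebar + d'))).
  assert (Hg : 0 < g) by (apply Rmin_pos; lra).
  apply is_lim_seq_spec in Hlim.
  destruct (Hlim (mkposreal g Hg)) as [N HN]; exists N; intros n Hn.
  specialize (HN n Hn); simpl in HN.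
  assert (H1 := Rlt_le_trans _ _ _ HN (Rmin_l _ _)).
  assert (H2 := Rlt_le_trans _ _ _ HN (Rmin_r _ _)).
  apply Rabs_def2 in H1; apply Rabs_def2 in H2.
  apply Rabs_def1.
  - apply Rnot_le_lt; intros H.
    assert (H' := sigma_E_nonincreasing V HV Hmax (Ebar + d') (e n) ltac:(lra) ltac:(lra)).
    lra.
  - apply Rnot_le_lt; intros H.
    assert (H' := sigma_E_nonincreasing V HV Hmax (e n) (Ebar - d') (He n) ltac:(lra)).
    lra.
Qed.

(** The error bound involves [u n] itself; once [eps n <= L / 2] it forces
    [u n <= 2 * s], which makes the bound effective. *)
Lemma lim_of_relative_error (eps u : nat -> R) (L s : R) :
  0 < L -> (forall n, 0 < eps n) -> (forall n, 0 < u n) -> is_lim_seq eps 0 ->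
  (forall n, Rabs (L * s - u n * L) <= eps n * u n) ->
  is_lim_seq u s.
Proof.
  intros HL He Hu Hlim Herr.
  assert (Hs : is_lim_seq (fun n => eps n * (2 * s / L)) 0).
  { replace 0 with (0 * (2 * s / L)) by ring.
    apply (is_lim_seq_scal_r eps (2 * s / L) 0), Hlim. }
  apply is_lim_seq_spec; intros d.
  apply is_lim_seq_spec in Hlim; apply is_lim_seq_spec in Hs.
  destruct (Hlim (mkposreal (L / 2) ltac:(lra))) as [N1 HN1].
  destruct (Hs d) as [N2 HN2].
  exists (N1 + N2)%nat; intros n Hn.
  specialize (HN1 n ltac:(lia)); specialize (HN2 n ltac:(lia)).
  specialize (Herr n); specialize (He n); specialize (Hu n).
  simpl in HN1; rewrite Rminus_0_r in HN1, HN2.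
  apply Rabs_def2 in HN1.
  assert (Hs2 : u n <= 2 * s).
  { apply (Rmult_le_reg_r L); [exact HL|].
    assert (eps n * u n <= L / 2 * u n) by (apply Rmult_le_compat_r; lra).
    assert (H' := Rle_abs (- (L * s - u n * L))); rewrite Rabs_Ropp in H'.
    lra. }
  apply Rle_lt_trans with (eps n * (2 * s / L));
    [| apply Rle_lt_trans with (2 := HN2), Rle_abs].
  apply (Rmult_le_reg_l L); [exact HL|].
  replace (L * (eps n * (2 * s / L))) with (eps n * (2 * s)) by (field; lra).
  rewrite <- (Rabs_right L) at 1 by lra.
  rewrite <- Rabs_mult, <- Rabs_Ropp.
  replace (- (L * (u n - s))) with (L * s - u n * L) by ring.
  apply Rle_trans with (1 := Herr), Rmult_le_compat_l; lra.
Qed.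

(** Functions within [eps n * u n] of the linear functions of slope [u n]
    through [a] converge, uniformly on bounded sets, to the one of slope
    [lim u]. *)
Lemma CVU_bounded_affine_error (f : nat -> R -> R) (eps u : nat -> R) (s a : R) :
  is_lim_seq eps 0 -> is_lim_seq u s ->
  (forall n x, Rabs (f n x - u n * (x - a)) <= eps n * u n) ->
  CVU_bounded f (fun x => s * (x - a)).
Proof.
  intros He Hu Herr c r d Hd.
  set (B := Rabs (c - a) + r).
  assert (Hlim : is_lim_seq (fun n => eps n * u n + Rabs (u n - s) * B) 0).
  { replace 0 with (0 * s + Rabs (s - s) * B)
      by (rewrite Rminus_diag, Rabs_R0; ring).
    apply is_lim_seq_plus'; [now apply is_lim_seq_mult'|].
    apply is_lim_seq_mult'; [|apply is_lim_seq_const].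
    apply (is_lim_seq_abs (fun n => u n - s) (s - s)).
    apply is_lim_seq_minus'; [exact Hu | apply is_lim_seq_const]. }
  apply is_lim_seq_spec in Hlim.
  destruct (Hlim (mkposreal d Hd)) as [N HN]; exists N; intros n x Hn Hx.
  specialize (HN n Hn); specialize (Herr n x); simpl in HN.
  rewrite Rminus_0_r in HN.
  unfold Boule in Hx.
  assert (HB : Rabs (x - a) <= B).
  { replace (x - a) with ((x - c) + (c - a)) by ring.
    apply Rle_trans with (1 := Rabs_triang _ _); unfold B; lra. }
  rewrite <- Rabs_Ropp.
  replace (- (s * (x - a) - f n x))
    with ((f n x - u n * (x - a)) + (u n - s) * (x - a)) by ring.
  apply Rle_lt_trans with (1 := Rabs_triang _ _).
  rewrite Rabs_mult.
  apply Rle_lt_trans with (2 := HN).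
  apply Rle_trans with (2 := Rle_abs _).
  apply Rplus_le_compat; [exact Herr|].
  apply Rmult_le_compat_l; [apply Rabs_pos | exact HB].
Qed.

Theorem theorem2p7 :
  forall (V : R -> R) (qa qb T : R)
    (eps : nat -> R) (q : R -> R -> R) (E : R -> R),
  is_C2 V -> one_periodic V -> is_max_value V 0 ->
  qa < qb -> 0 < T ->
  (forall n, 0 < eps n) -> is_lim_seq eps 0 ->
  (forall n, newton_eq V (eps n) (q (eps n))) ->
  (forall n t, 0 < Derive (q (eps n)) t) ->
  (forall n, q (eps n) 0 = qa) ->
  (forall n, q (eps n) T = qb) ->
  (forall n, 0 < E (eps n)) ->
  (forall n, energy_eq V (eps n) (q (eps n)) (E (eps n))) ->
  exists (phi : nat -> nat) (Ebar : R),
    (forall m n, (m < n)%nat -> (phi m < phi n)%nat) /\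
    0 < Ebar /\
    CVU_bounded
      (fun k => t_fun V (eps (phi k)) (E (eps (phi k))) qa)
      (fun x => sigma_E V Ebar * (x - qa)) /\
    is_lim_seq (fun k => E (eps (phi k))) Ebar.
Proof.
  intros V qa qb T eps q E HC2 Hper HM Hab HT Heps Hlim Hnew Hinc Hqa Hqb HE Hen.
  assert (HV := C2_continuous V HC2).
  assert (Hs : 0 < T / (qb - qa)) by (apply Rdiv_lt_0_compat; lra).
  destruct (sigma_E_surjective V _ HC2 Hper HM Hs) as [Ebar [HEbar HsE]].
  destruct HM as [Hmax _].
  assert (Herr : forall n x,
    Rabs (t_fun V (eps n) (E (eps n)) qa x - sigma_E V (E (eps n)) * (x - qa))
    <= eps n * sigma_E V (E (eps n))).
  { intros n x; now apply t_fun_mean. }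
  assert (Hsig : is_lim_seq (fun n => sigma_E V (E (eps n))) (sigma_E V Ebar)).
  { rewrite HsE.
    apply (lim_of_relative_error eps _ (qb - qa)); auto; [lra | |].
    - intros n; now apply sigma_E_pos.
    - intros n.
      replace ((qb - qa) * (T / (qb - qa)))
        with (t_fun V (eps n) (E (eps n)) qa qb); [apply Herr|].
      rewrite <- (Hqa n), <- (Hqb n) at 1.
      rewrite (t_fun_travel_time V HV Hmax) by auto.
      field; lra. }
  exists (fun n => n), Ebar; repeat split; auto.
  - exact (CVU_bounded_affine_error _ eps _ _ qa Hlim Hsig Herr).
  - apply (sigma_E_lim_inv V); auto.
Qed.
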